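(* Let $U\in\mathcal{CU}_\mu(\mathcal H)$ and consider the sequence $\{U_n\}$ of its truncations. Then: (1) $\{U_n\}$ converges strongly to $U$: $\lim_{n\to\infty}\|U_nx-Ux\|_{l^2(\mathbb N_0,\mu)}=0$ for every $x\in\mathcal H$; (2) for every $m\in\mathbb N_0$, with $\mathbf B_n=b(U_n)$ and $\mathbf B=b(U)$, the sequence $\{\mathbf B_n^m\}$ converges strongly to $\mathbf B^m$: $\lim_{n\to\infty}\|\mathbf B_n^mx-\mathbf B^mx\|_{l^1(\mathbb N_0)}=0$ for every $x\in l^1(\mathbb N_0)$.
   Context: Let $\mu_j>0$ ($j\in\mathbb N_0=\{0,1,\dots\}$) with $\sum_j\mu_j=1$. $\mathcal H=l^2(\mathbb N_0,\mu)$ is the Hilbert space of complex sequences with $\langle x,y\rangle=\sum_j\mu_jx_j\overline{y_j}$, $\|x\|=\sqrt{\langle x,x\rangle}$. $\mathcal{CU}_\mu(\mathcal H)$ is the set of bounded linear operators $U$ on $\mathcal H$ with $\|Ux\|\le\|x\|$ for all $x$. Matrix entries: $(Ux)_j=\sum_kU_{jk}x_k$. $b(U)$ is the operator on $l^1(\mathbb N_0)$ (norm $\sum_j|x_j|$) with matrix $b(U)_{jk}=\frac{\mu_j}{\mu_k}|U_{jk}|^2$. Let $p_n(x_0,x_1,\dots)=(x_0,\dots,x_{n-1})$ and $q_n(x_0,\dots,x_{n-1})=(x_0,\dots,x_{n-1},0,0,\dots)$, and $U_n=p_nUq_n:\mathbb C^n\to\mathbb C^n$. In the statement $U_n$ is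 regarded as an operator on $\mathcal H$ via $q_nU_np_n$, so its matrix is $U_{jk}$ for $j,k<n$ and $0$ otherwise, and correspondingly $b(U_n)$ is the operator on $l^1(\mathbb N_0)$ with entries $b(U)_{jk}$ for $j,k<n$ and $0$ otherwise. Zeroth powers are the identity. *)

(* Defs.v *)
From HB Require Import structures.
From mathcomp Require Import all_boot all_order all_algebra.
From mathcomp Require Import complex.
From mathcomp Require Import all_classical all_reals all_analysis.
From mathcomp Require Import ring.

Set Implicit Arguments.
Unset Strict Implicit.
Unset Printing Implicit Defensive.

Import Order.TTheory GRing.Theory Num.Theory.
Import numFieldNormedType.Exports.
Import Normc.

Local Open Scope classical_set_scope.
Local Open Scope ring_scope.
Local Open Scope complex_scope.

Section sequences_aux.
Variable R : realType.

Lemma normc_ge0 (z : R[i]) : 0 <= normc z.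
Proof. by case: z => a b; exact: sqrtr_ge0. Qed.

Lemma normc_real (r : R) : normc (r%:C) = `|r|.
Proof. by rewrite /= expr0n addr0 sqrtr_sqr. Qed.

Lemma ler_normc_add (x y : R[i]) : normc (x + y) <= normc x + normc y.
Proof. exact: le_normcD. Qed.

Lemma ler_normc_sum (n : nat) (x : 'I_n -> R[i]) :
  normc (\sum_(k < n) x k) <= \sum_(k < n) normc (x k).
Proof.
elim/big_ind2 : _ => [|u a v c ha hc|//]; first by rewrite normc0.
by rewrite (le_trans (ler_normc_add _ _))// lerD.
Qed.

Lemma normc_Re (z : R[i]) : `|complex.Re z| <= normc z.
Proof. by case: z => a b /=; rewrite -sqrtr_sqr ler_wsqrtr// lerDl sqr_ge0. Qed.

Lemma normc_Im (z : R[i]) : `|complex.Im z| <= normc z.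
Proof. by case: z => a b /=; rewrite -sqrtr_sqr ler_wsqrtr// lerDr sqr_ge0. Qed.

Lemma normc_le_ReIm (z : R[i]) : normc z <= `|complex.Re z| + `|complex.Im z|.
Proof.
case: z => a b /=; rewrite -[leRHS]ger0_norm ?addr_ge0// -sqrtr_sqr.
rewrite ler_wsqrtr// sqrrD !real_normK ?num_real//.
by rewrite addrAC lerDl mulrn_wge0 ?mulr_ge0.
Qed.

Lemma cvg_normcP (u : nat -> R[i]) (l : R[i]) :
  (u : nat -> R[i]^o) @ \oo --> (l : R[i]^o) <->
  (fun n => normc (u n - l)) @ \oo --> (0 : R).
Proof.
split=> h.
- apply/cvgr0Pnorm_lt => e e0.
  have e0' : 0 < e%:C by rewrite ltcR.
  move/cvgr_dist_lt : h => /(_ _ e0').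
  apply: filterS => n; rewrite distrC.
  have -> : `|u n - l| = (normc (u n - l))%:C by [].
  by rewrite ltcR ger0_norm// normc_ge0.
- apply/cvgrPdist_lt => -[e e'] /[dup] e0.
  rewrite ltcE/= => /andP[/eqP e'0 {}e0]; rewrite e'0.
  move/cvgr0Pnorm_lt : h => /(_ _ e0).
  apply: filterS => n; rewrite ger0_norm ?normc_ge0// => h.
  rewrite distrC.
  have -> : `|u n - l| = (normc (u n - l))%:C by [].
  by rewrite -[ltRHS]/(e%:C) ltcR.
Qed.

Lemma cvg_normc (u : nat -> R[i]) (l : R[i]) :
  (u : nat -> R[i]^o) @ \oo --> (l : R[i]^o) ->
  (fun n => normc (u n)) @ \oo --> normc l.
Proof.
move/cvg_normcP => h; apply/cvgrPdist_le => e e0.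
move/cvgr0Pnorm_lt : h => /(_ _ e0); apply: filterS => n.
rewrite ger0_norm ?normc_ge0// => /ltW; apply: le_trans.
rewrite distrC ler_norml; apply/andP; split.
  rewrite lerNl opprB lerBlDr -[normc (u n - l)]normcN opprB.
  by rewrite -{1}(subrK (u n) l) ler_normc_add.
by rewrite lerBlDr -{1}(subrK l (u n)) ler_normc_add.
Qed.

Lemma cvg_ReIm (u : nat -> R[i]) (a b : R) :
  (fun n => complex.Re (u n)) @ \oo --> a ->
  (fun n => complex.Im (u n)) @ \oo --> b ->
  (u : nat -> R[i]^o) @ \oo --> (a +i* b : R[i]^o).
Proof.
move=> ha hb; apply/cvg_normcP.
apply: (@squeeze_cvgr _ _ _ _ (fun=> 0)
  (fun n => `|complex.Re (u n) - a| + `|complex.Im (u n) - b|)).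
- apply: nearW => n; rewrite normc_ge0/=.
  apply: le_trans (normc_le_ReIm _) _.
  by case: (u n).
- exact: cvg_cst.
- rewrite -[X in _ --> X](addr0 0).
  apply: cvgD; rewrite -[X in _ --> X](@normr0 _ R); apply: cvg_norm.
    by rewrite -(subrr a); apply: cvgB => //; exact: cvg_cst.
  by rewrite -(subrr b); apply: cvgB => //; exact: cvg_cst.
Qed.

Lemma series_ReE (u : nat -> R[i]) n :
  complex.Re (series (u : nat -> R[i]^o) n) = series (fun k => complex.Re (u k)) n.
Proof.
rewrite /series/= !big_mkord; elim: n => [|n IH]; first by rewrite !big_ord0.
by rewrite !big_ord_recr/= -IH; case: (\sum_(i < n) _) (u n) => ? ? [].
Qed.

Lemma series_ImE (u : nat -> R[i]) n :
  complex.Im (series (u : nat -> R[i]^o) n) = series (fun k => complex.Im (u k)) n.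
Proof.
rewrite /series/= !big_mkord; elim: n => [|n IH]; first by rewrite !big_ord0.
by rewrite !big_ord_recr/= -IH; case: (\sum_(i < n) _) (u n) => ? ? [].
Qed.

Lemma abs_cvg_series (u : nat -> R[i]) :
  cvgn (series (fun k => normc (u k))) -> cvgn (series (u : nat -> R[i]^o)).
Proof.
move=> h.
have hR : cvgn (series (fun k => complex.Re (u k))).
  apply: normed_cvg; apply: series_le_cvg h => n //=.
    exact: normc_ge0.
  exact: normc_Re.
have hI : cvgn (series (fun k => complex.Im (u k))).
  apply: normed_cvg; apply: series_le_cvg h => n //=.
    exact: normc_ge0.
  exact: normc_Im.
apply/cvg_ex; eexists; apply: cvg_ReIm.
- by under eq_fun do rewrite series_ReE; exact: hR.
- by under eq_fun do rewrite series_ImE; exact: hI.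
Qed.

Lemma cvg_series_finsupp (u : nat -> R) (n : nat) :
  (forall j, (n <= j)%N -> u j = 0) -> series u @ \oo --> \sum_(j < n) u j.
Proof.
move=> h; apply: cvg_near_cst; exists n => // k /= nk.
rewrite /series/= -(big_mkord xpredT u) (big_cat_nat (n := n))//=.
rewrite -[RHS]addr0; congr (_ + _); rewrite big_nat_cond big1// => j.
by case/andP => /andP[/h].
Qed.

Lemma ler_series_lim (u : nat -> R) (n : nat) :
  (forall j, 0 <= u j) -> cvgn (series u) -> \sum_(j < n) u j <= limn (series u).
Proof.
move=> u0 cu; rewrite -(big_mkord xpredT u).
apply: (nondecreasing_cvgn_le _ cu n).
by apply: nondecreasing_series => k _ _; exact: u0.
Qed.

Lemma bounded_series_cvg (u : nat -> R) (M : R) :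
  (forall j, 0 <= u j) -> (forall n, \sum_(j < n) u j <= M) ->
  cvgn (series u) /\ limn (series u) <= M.
Proof.
move=> u0 uM.
have cu : cvgn (series u).
  apply: nondecreasing_is_cvgn.
    by apply: nondecreasing_series => k _ _; exact: u0.
  by exists M => _ [n _ <-]; rewrite /series/= big_mkord.
split=> //; apply: limr_le => //.
by apply: nearW => n; rewrite /series/= big_mkord.
Qed.

(* R[i] carries its norm topology through the regular module R[i]^o. *)
Definition csum (u : nat -> R[i]) : R[i] :=
  limn (series (u : nat -> R[i]^o)).

Lemma csum_eq (u : nat -> R[i]) (l : R[i]) :
  series (u : nat -> R[i]^o) @ \oo --> (l : R[i]^o) -> csum u = l.
Proof. exact: (@cvg_lim R[i]^o). Qed.

End sequences_aux.

Section ell2.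
Variables (R : realType) (mu : nat -> {posnum R}).

(* Positivity of the weights is carried by their type; that they sum to 1 is
   never needed for the definitions. *)
Definition sq_summable : {pred nat -> R[i]} :=
  mem [set x | cvgn (series (fun j => (mu j)%:num * normc (x j) ^+ 2))].

Record ell2 := L2 { l2_seq :> nat -> R[i] ; l2_seqP : l2_seq \in sq_summable }.

HB.instance Definition _ := [isSub for l2_seq].
HB.instance Definition _ := [Choice of ell2 by <:].

Lemma sq_summable_submod_closed : submod_closed sq_summable.
Proof.
split=> [|a x y].
  rewrite inE/=; apply/cvg_ex; exists (\sum_(j < 0) 0).
  have -> : (fun j => (mu j)%:num * normc ((0 : nat -> R[i]) j) ^+ 2) = fun=> 0.
    by apply/funext => j; rewrite normc0 expr0n mulr0.
  exact: cvg_series_finsupp.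
rewrite !inE/= => cx cy.
have m0 j : 0 <= (mu j)%:num by [].
pose v j := 2 * (normc a ^+ 2 * ((mu j)%:num * normc (x j) ^+ 2) +
                 (mu j)%:num * normc (y j) ^+ 2).
apply: (@series_le_cvg _ _ v) => [j|j|j|].
- by rewrite mulr_ge0 ?exprn_ge0 ?normc_ge0.
- by rewrite /v mulr_ge0// addr_ge0// !mulr_ge0 ?exprn_ge0 ?normc_ge0.
- have h : normc ((a *: x + y) j) <= normc a * normc (x j) + normc (y j).
    by rewrite -normcM; exact: ler_normc_add.
  have -> : v j = (mu j)%:num *
      (2 * ((normc a * normc (x j)) ^+ 2 + normc (y j) ^+ 2)).
    by rewrite /v; ring.
  rewrite ler_wpM2l//.
  apply: (@le_trans _ _ ((normc a * normc (x j) + normc (y j)) ^+ 2)).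
    by rewrite lerXn2r ?nnegrE ?addr_ge0 ?mulr_ge0 ?normc_ge0.
  rewrite -subr_ge0.
  set p := normc a * _; set q := normc (y j).
  rewrite (_ : _ - _ = (p - q) ^+ 2) ?sqr_ge0//; by ring.
- apply: is_cvg_seriesZ; apply: is_cvg_seriesD => //.
  exact: is_cvg_seriesZ.
Qed.

HB.instance Definition _ :=
  GRing.isSubmodClosed.Build _ _ sq_summable sq_summable_submod_closed.
HB.instance Definition _ := [SubChoice_isSubLmodule of ell2 by <:].

Definition l2dot (x y : ell2) : R[i] :=
  csum (fun j => ((mu j)%:num)%:C * x j * (y j)^*).

Definition l2norm (x : ell2) : R :=
  Num.sqrt (limn (series (fun j => (mu j)%:num * normc (x j) ^+ 2))).

Lemma l2_cvg (x : ell2) :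
  cvgn (series (fun j => (mu j)%:num * normc (x j) ^+ 2)).
Proof. by have := l2_seqP x; rewrite inE. Qed.
Arguments l2_cvg : clear implicits.

Lemma l2_term_ge0 (x : nat -> R[i]) j : 0 <= (mu j)%:num * normc (x j) ^+ 2.
Proof. by rewrite mulr_ge0 ?exprn_ge0 ?normc_ge0. Qed.

Lemma l2_lim_ge0 (x : ell2) :
  0 <= limn (series (fun j => (mu j)%:num * normc (x j) ^+ 2)).
Proof.
apply: le_trans _ (ler_series_lim 0 (l2_term_ge0 x) (l2_cvg x)).
by rewrite big_ord0.
Qed.

Lemma l2norm_sqr (x : ell2) : (l2norm x ^+ 2)%:C = l2dot x x.
Proof.
rewrite sqr_sqrtr ?l2_lim_ge0//; apply/esym/csum_eq.
have e j : ((mu j)%:num)%:C * x j * (x j)^* =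
    ((mu j)%:num * normc (x j) ^+ 2)%:C.
  rewrite -mulrA; case: (x j) => a b /=.
  rewrite sqr_sqrtr ?addr_ge0 ?sqr_ge0//.
  by simpc; congr (_ +i* _); ring.
under eq_fun do rewrite e.
apply: cvg_ReIm.
  by under eq_fun do rewrite series_ReE; exact: l2_cvg.
under eq_fun do rewrite series_ImE.
have := @cvg_series_finsupp R (fun=> 0) 0 (fun _ _ => erefl).
by rewrite big_ord0.
Qed.

Lemma ler_l2norm (x y : ell2) :
  (forall j, normc (x j) <= normc (y j)) -> l2norm x <= l2norm y.
Proof.
move=> h; apply: ler_wsqrtr; apply: lim_series_le; [exact: l2_cvg..|].
by move=> j; rewrite ler_wpM2l// lerXn2r// nnegrE normc_ge0.
Qed.

Definition unit_seq (k j : nat) : R[i] := (j == k)%:R.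

Lemma unit_seq_cvg k :
  series (fun j => (mu j)%:num * normc (unit_seq k j) ^+ 2) @ \oo -->
  (mu k)%:num.
Proof.
have e : \sum_(j < k.+1) (mu j)%:num * normc (unit_seq k j) ^+ 2 = (mu k)%:num.
  rewrite big_ord_recr/= big1 ?add0r => [|j _]; last first.
    by rewrite /unit_seq ltn_eqF// normc0 expr0n mulr0.
  by rewrite /unit_seq eqxx normc1 expr1n mulr1.
rewrite -e; apply: cvg_series_finsupp => j kj.
by rewrite /unit_seq gtn_eqF// normc0 expr0n mulr0.
Qed.

Lemma unit_seqP k : unit_seq k \in sq_summable.
Proof. by rewrite inE/=; apply/cvg_ex; eexists; exact: unit_seq_cvg. Qed.

Definition l2unit k : ell2 := L2 (unit_seqP k).

Lemma l2norm_unit k : l2norm (l2unit k) ^+ 2 = (mu k)%:num.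
Proof.
by rewrite sqr_sqrtr ?l2_lim_ge0//; apply/cvg_lim => //; exact: unit_seq_cvg.
Qed.

(* coords and pad are p_n : l^2 -> C^n and q_n : C^n -> l^2. *)
Definition coords n (x : ell2) : 'cV[R[i]]_n := \col_(i < n) x i.

Definition pad_seq n (v : 'cV[R[i]]_n) (j : nat) : R[i] :=
  if insub j is Some i then v i 0 else 0.

Lemma pad_seqP n (v : 'cV[R[i]]_n) : pad_seq v \in sq_summable.
Proof.
rewrite inE/=; apply/cvg_ex; eexists; apply: (@cvg_series_finsupp _ _ n).
by move=> j nj; rewrite /pad_seq insubF ?ltnNge ?nj// normc0 expr0n mulr0.
Qed.

Definition pad n (v : 'cV[R[i]]_n) : ell2 := L2 (pad_seqP v).

Lemma coords_is_linear n : linear (@coords n).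
Proof. by move=> a x y; apply/matrixP => i j; rewrite !mxE. Qed.

HB.instance Definition _ n :=
  GRing.isLinear.Build R[i] ell2 'cV[R[i]]_n _ (@coords n) (@coords_is_linear n).

Lemma pad_is_linear n : linear (@pad n).
Proof.
move=> a v w; apply/val_inj/funext => j /=.
rewrite -[RHS]/(a * pad_seq v j + pad_seq w j) /pad_seq.
case: insubP => [i _ _|_]; first by rewrite !mxE.
by rewrite mulr0 addr0.
Qed.

HB.instance Definition _ n :=
  GRing.isLinear.Build R[i] 'cV[R[i]]_n ell2 _ (@pad n) (@pad_is_linear n).

Lemma pad_coordsE n (x : ell2) j : pad (coords n x) j = if (j < n)%N then x j else 0.
Proof. by rewrite /= /pad_seq; case: insubP => [i -> <-|/negbTE->]; rewrite ?mxE. Qed.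

Lemma l2norm_pad_coords n (x : ell2) : l2norm (pad (coords n x)) <= l2norm x.
Proof.
apply: ler_l2norm => j; rewrite pad_coordsE; case: ifP => // _.
by rewrite normc0 normc_ge0.
Qed.

Lemma normc_l2norm (x : ell2) j : (mu j)%:num * normc (x j) ^+ 2 <= l2norm x ^+ 2.
Proof.
rewrite sqr_sqrtr ?l2_lim_ge0//.
apply: le_trans (ler_series_lim j.+1 (l2_term_ge0 x) (l2_cvg x)).
rewrite big_ord_recr/= lerDr; apply: sumr_ge0 => i _; exact: l2_term_ge0.
Qed.

Lemma pad_coords_cvg (x : ell2) :
  (fun n => l2norm (pad (coords n x) - x)) @ \oo --> (0 : R).
Proof.
pose t j := (mu j)%:num * normc (x j) ^+ 2.
pose L : R := limn (series t).
have e n : l2norm (pad (coords n x) - x) = Num.sqrt (L - series t n).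
  congr Num.sqrt; apply/cvg_lim => //.
  have h : (fun N => series t N - series t n) @ \oo --> L - series t n.
    by apply: cvgB; [exact: l2_cvg|exact: cvg_cst].
  refine (cvg_trans _ h).
  apply: near_eq_cvg; exists n => // N /= nN.
  rewrite {1}/series/= (big_cat_nat (n := n) _ nN)//= addrAC subrr add0r.
  rewrite /series/= [RHS](big_cat_nat (n := n) _ nN)//=.
  rewrite [X in _ = X + _]big_nat_cond [X in _ = X + _]big1 ?add0r; last first.
    move=> k /andP[/andP[_ kn] _].
    rewrite -[(_ - _) k]/(pad (coords n x) k - x k) pad_coordsE kn subrr.
    by rewrite normc0 expr0n mulr0.
  rewrite big_nat_cond [RHS]big_nat_cond.
  apply: eq_bigr => k /andP[/andP[nk _] _].
  rewrite -[(_ - _) k]/(pad (coords n x) k - x k) pad_coordsE ltnNge nk/=.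
  by rewrite sub0r normcN.
under eq_fun do rewrite e.
have -> : (0 : R) = Num.sqrt (L - L) by rewrite subrr sqrtr0.
have h : (fun n => L - series t n) @ \oo --> L - L.
  by apply: cvgB; [exact: cvg_cst|exact: l2_cvg].
exact: (cvg_comp _ _ h (@sqrt_continuous R (L - L))).
Qed.

Record contractive_op := Contractive {
  contractive_fun :> {linear ell2 -> ell2} ;
  contractive_opP : forall x, l2norm (contractive_fun x) <= l2norm x }.

(* Evaluating (U x)_j = \sum_k U_jk x_k at x = e_k forces this value; entryE
   below is the expansion for every x. *)
Definition entry (U : ell2 -> ell2) (j k : nat) : R[i] := U (l2unit k) j.

(* U_n = p_n U q_n on C^n; trunc_fun is q_n U_n p_n on l^2. *)
Definition trunc_fin (U : contractive_op) n :
  {linear 'cV[R[i]]_n -> 'cV[R[i]]_n} :=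
  @coords n \o U \o @pad n.

Definition trunc_fun (U : contractive_op) n : {linear ell2 -> ell2} :=
  @pad n \o trunc_fin U n \o @coords n.

Lemma trunc_contraction (U : contractive_op) n x :
  l2norm (trunc_fun U n x) <= l2norm x.
Proof.
apply: le_trans (l2norm_pad_coords n _) _.
by apply: le_trans (contractive_opP U _) _; exact: l2norm_pad_coords.
Qed.

Definition truncation (U : contractive_op) n : contractive_op :=
  Contractive (trunc_contraction U n).

Lemma pad_coords_sum n (x : ell2) :
  pad (coords n x) = \sum_(k < n) x k *: l2unit k.
Proof.
apply/val_inj/funext => j.
have -> : val (\sum_(k < n) x k *: l2unit k) j = \sum_(k < n) x k * unit_seq k j.
  elim/big_ind2 : _ => [//|u a v c <- <-//|k _ //].
rewrite [LHS]pad_coordsE; case: ifPn => [jn|].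
  rewrite (bigD1 (Ordinal jn))//= /unit_seq eqxx mulr1 big1 ?addr0// => k.
  by rewrite -val_eqE/= => /negbTE; rewrite eq_sym => ->; rewrite mulr0.
rewrite -leqNgt => nj; rewrite big1// => k _.
by rewrite /unit_seq gtn_eqF ?mulr0// (leq_trans _ nj).
Qed.

Lemma entryE (U : contractive_op) (x : ell2) j :
  csum (fun k => entry U j k * x k) = U x j.
Proof.
apply/csum_eq/cvg_normcP.
pose c := Num.sqrt (mu j)%:num.
have c0 : 0 < c by rewrite sqrtr_gt0.
apply: (@squeeze_cvgr _ _ _ _ (fun=> 0)
    (fun n => c^-1 * l2norm (pad (coords n x) - x))); last 2 first.
- exact: cvg_cst.
- by rewrite -[X in _ --> X](mulr0 c^-1); apply: cvgM;
    [exact: cvg_cst|exact: pad_coords_cvg].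
apply: nearW => n; rewrite normc_ge0/=.
have -> : series (fun k => entry U j k * x k : R[i]^o) n - U x j =
    U (pad (coords n x) - x) j.
  rewrite linearB -[RHS]/(U (pad (coords n x)) j - U x j); congr (_ - _).
  rewrite pad_coords_sum linear_sum /series/= big_mkord.
  have -> : l2_seq (\sum_(k < n) U (x k *: l2unit k)) j =
      \sum_(k < n) (U (x k *: l2unit k)) j.
    by elim/big_ind2 : _ => [//|u a v d <- <-//|k _ //].
  by apply: eq_bigr => k _; rewrite linearZ/= mulrC.
rewrite mulrC ler_pdivlMr//.
apply: le_trans (contractive_opP U _).
rewrite -(@ler_pXn2r _ 2)// ?nnegrE ?mulr_ge0 ?normc_ge0 ?sqrtr_ge0//.
by rewrite exprMn sqr_sqrtr// mulrC normc_l2norm.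
Qed.

Lemma entry_trunc (U : contractive_op) n j k :
  entry (truncation U n) j k = if (j < n)%N && (k < n)%N then entry U j k else 0.
Proof.
rewrite /entry [LHS]pad_coordsE; case: ifP => //= jn; case: ifP => kn.
  congr (U _ j); apply/val_inj/funext => i /=; rewrite [LHS]pad_coordsE.
  by case: ifP => // iN; rewrite /= /unit_seq; case: eqP iN => // ->; rewrite kn.
have -> : pad (coords n (l2unit k)) = 0; last by rewrite linear0.
apply/val_inj/funext => i /=; rewrite [LHS]pad_coordsE.
by case: ifP => // iN; rewrite /= /unit_seq; case: eqP iN => // ->; rewrite kn.
Qed.

End ell2.

Arguments l2_cvg {R mu} x.

Section ell1.
Variable R : realType.

Definition abs_summable : {pred nat -> R[i]} :=
  mem [set x | cvgn (series (fun j => normc (x j)))].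

Record ell1 := L1 { l1_seq :> nat -> R[i] ; l1_seqP : l1_seq \in abs_summable }.

HB.instance Definition _ := [isSub for l1_seq].
HB.instance Definition _ := [Choice of ell1 by <:].

Lemma abs_summable_submod_closed : submod_closed abs_summable.
Proof.
split=> [|a x y].
  rewrite inE/=; apply/cvg_ex; exists (\sum_(j < 0) 0).
  have -> : (fun j => normc ((0 : nat -> R[i]) j)) = fun=> 0.
    by apply/funext => j; rewrite normc0.
  exact: cvg_series_finsupp.
rewrite !inE/= => cx cy.
apply: (@series_le_cvg _ _ (fun j => normc a * normc (x j) + normc (y j))).
- by move=> j; exact: normc_ge0.
- by move=> j; rewrite addr_ge0 ?mulr_ge0 ?normc_ge0.
- by move=> j; rewrite -normcM; exact: ler_normc_add.
- by apply: is_cvg_seriesD => //; exact: is_cvg_seriesZ.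
Qed.

HB.instance Definition _ :=
  GRing.isSubmodClosed.Build _ _ abs_summable abs_summable_submod_closed.
HB.instance Definition _ := [SubChoice_isSubLmodule of ell1 by <:].

Definition l1norm (x : ell1) : R := limn (series (fun j => normc (x j))).

Lemma l1_cvg (x : ell1) : cvgn (series (fun j => normc (x j))).
Proof. by have := l1_seqP x; rewrite inE. Qed.
Arguments l1_cvg : clear implicits.

End ell1.

Arguments l1_cvg {R} x.

Section b.
Variables (R : realType) (mu : nat -> {posnum R}).
Implicit Type U : contractive_op mu.

Definition bop_entry U (j k : nat) : R :=
  (mu j)%:num / (mu k)%:num * normc (entry U j k) ^+ 2.

Lemma b_entry_ge0 U j k : 0 <= bop_entry U j k.
Proof. by rewrite mulr_ge0 ?exprn_ge0 ?normc_ge0. Qed.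

Lemma b_col_sum U k n : \sum_(j < n) bop_entry U j k <= 1.
Proof.
have -> : \sum_(j < n) bop_entry U j k =
    (\sum_(j < n) (mu j)%:num * normc (U (l2unit mu k) j) ^+ 2) / (mu k)%:num.
  by rewrite mulr_suml; apply: eq_bigr => j _; rewrite /bop_entry /entry mulrAC.
rewrite ler_pdivrMr// mul1r -l2norm_unit.
apply: (@le_trans _ _ (l2norm (U (l2unit mu k)) ^+ 2)); last first.
  by rewrite lerXn2r ?nnegrE ?sqrtr_ge0// contractive_opP.
rewrite sqr_sqrtr ?l2_lim_ge0//.
exact: ler_series_lim (l2_term_ge0 _ _) (l2_cvg (U (l2unit mu k))).
Qed.

Lemma b_entry_le1 U j k : bop_entry U j k <= 1.
Proof.
apply: le_trans (b_col_sum U k j.+1); rewrite big_ord_recr/= lerDr.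
by apply: sumr_ge0 => i _; exact: b_entry_ge0.
Qed.

Lemma b_entry_trunc U n j k :
  bop_entry (truncation U n) j k =
  if (j < n)%N && (k < n)%N then bop_entry U j k else 0.
Proof.
by rewrite /bop_entry entry_trunc; case: ifP => // _; rewrite normc0 expr0n mulr0.
Qed.

Definition bop_seq U (x : ell1 R) (j : nat) : R[i] :=
  csum (fun k => (bop_entry U j k)%:C * x k).

Lemma normc_bE U (x : nat -> R[i]) j k :
  normc ((bop_entry U j k)%:C * x k) = bop_entry U j k * normc (x k).
Proof. by rewrite normcM normc_real ger0_norm// b_entry_ge0. Qed.

Lemma b_row_cvg U (x : ell1 R) j :
  cvgn (series (fun k => (bop_entry U j k)%:C * x k) : nat -> R[i]^o).
Proof.
apply: abs_cvg_series; apply: series_le_cvg (l1_cvg x) => k; try exact: normc_ge0.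
by rewrite normc_bE ler_piMl ?normc_ge0 ?b_entry_le1.
Qed.

Arguments b_row_cvg : clear implicits.

Lemma b_seq_sum U (x : ell1 R) n : \sum_(j < n) normc (bop_seq U x j) <= l1norm x.
Proof.
pose S K := \sum_(j < n)
  normc (series (fun k => (bop_entry U j k)%:C * x k : R[i]^o) K).
have cS : S @ \oo --> \sum_(j < n) normc (bop_seq U x j).
  by apply: cvg_big => [|j _]; [exact: add_continuous|apply: cvg_normc; exact: b_row_cvg].
rewrite -(cvg_lim _ cS)//; apply: limr_le; first by apply/cvg_ex; eexists; exact: cS.
apply: nearW => K.
apply: (@le_trans _ _ (\sum_(k < K) normc (x k))); last first.
  exact: ler_series_lim (fun j => normc_ge0 _) (l1_cvg x).
apply: (@le_trans _ _ (\sum_(j < n) \sum_(k < K) bop_entry U j k * normc (x k))).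
  apply: ler_sum => j _; rewrite /series/= big_mkord.
  have := ler_normc_sum (fun k : 'I_K => (bop_entry U j k)%:C * x k).
  move/le_trans; apply.
  by apply: ler_sum => k _; rewrite normc_bE.
rewrite exchange_big/=; apply: ler_sum => k _.
by rewrite -mulr_suml ler_piMl ?normc_ge0// b_col_sum.
Qed.

Lemma b_seqP U (x : ell1 R) : bop_seq U x \in @abs_summable R.
Proof.
rewrite inE/=.
by have [] := bounded_series_cvg (fun j => normc_ge0 (bop_seq U x j)) (b_seq_sum U x).
Qed.

Definition bop U (x : ell1 R) : ell1 R := L1 (b_seqP U x).

Lemma l1norm_b U x : l1norm (bop U x) <= l1norm x.
Proof. by have [] := bounded_series_cvg (fun j => normc_ge0 (bop_seq U x j)) (b_seq_sum U x). Qed.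

Lemma b_is_linear U : linear (bop U).
Proof.
move=> a x y; apply/val_inj/funext => j /=.
apply: csum_eq.
have -> : series (fun k => (bop_entry U j k)%:C * (a *: x + y : ell1 R) k : R[i]^o) =
    a \*: series (fun k => (bop_entry U j k)%:C * x k : R[i]^o) \+
    series (fun k => (bop_entry U j k)%:C * y k : R[i]^o).
  apply/funext => n; rewrite /series/= scaler_sumr -big_split/=.
  by apply: eq_bigr => k _; rewrite fctE /= mulrDr scalerAr.
apply: cvgD; last exact: b_row_cvg.
by apply: cvgZr; exact: b_row_cvg.
Qed.

HB.instance Definition _ U :=
  GRing.isLinear.Build R[i] (ell1 R) (ell1 R) _ (bop U) (b_is_linear U).

End b.

(* Main.v *)
Require Import Defs.
From mathcomp Require Import all_boot all_order all_algebra.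
From mathcomp Require Import complex.
From mathcomp Require Import all_classical all_reals all_analysis.
From mathcomp Require Import ring lra.

Import Order.TTheory GRing.Theory Num.Theory.
Import numFieldNormedType.Exports.

Local Open Scope classical_set_scope.
Local Open Scope ring_scope.

(** Let [P_n] be the coordinate projection onto the first [n] coordinates; it is
    a contraction and tends strongly to the identity on both spaces.  Since
    [U_n = P_n U P_n] and [B_n = P_n B P_n], writing
    [P_n T P_n x - T x = P_n T (P_n x - x) + (P_n (T x) - T x)] gives strong
    convergence for any contraction [T].  Powers follow by induction from
    [B_n^(m+1) x - B^(m+1) x = B_n (B_n^m x - B^m x) + (B_n - B) (B^m x)]. *)

Lemma l2norm_ge0 {R : realType} {mu : nat -> {posnum R}} (x : ell2 mu) :
  0 <= l2norm x.
Proof. exact: sqrtr_ge0. Qed.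

(* The constant 2 avoids Minkowski's inequality: [|a + b|^2 <= 2 (|a|^2 + |b|^2)]
   termwise is enough for limits. *)
Lemma l2norm_quasi_triangle {R : realType} {mu : nat -> {posnum R}}
    (x y : ell2 mu) : l2norm (x + y) <= 2 * (l2norm x + l2norm y).
Proof.
rewrite -(@ler_pXn2r _ 2)// ?nnegrE ?mulr_ge0 ?addr_ge0 ?l2norm_ge0//.
(* Squared norms are sums of series, so this intermediate bound can be checked term by term. *)
apply: (@le_trans _ _ (2 * (l2norm x ^+ 2 + l2norm y ^+ 2))); last first.
  have := l2norm_ge0 x; have := l2norm_ge0 y; nra.
rewrite !sqr_sqrtr ?l2_lim_ge0//.
have h : series (fun j => 2 * ((mu j)%:num * Normc.normc (x j) ^+ 2 +
      (mu j)%:num * Normc.normc (y j) ^+ 2)) @ \oo -->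
    2 * (limn (series (fun j => (mu j)%:num * Normc.normc (x j) ^+ 2)) +
         limn (series (fun j => (mu j)%:num * Normc.normc (y j) ^+ 2))).
  rewrite (_ : series _ = (fun=> 2) \*
    (series (fun j => (mu j)%:num * Normc.normc (x j) ^+ 2) +
     series (fun j => (mu j)%:num * Normc.normc (y j) ^+ 2))); last first.
    apply/funext => n; rewrite /= -[RHS]/(2 * (_ + _)) /series/= -mulr_sumr.
    by rewrite big_split.
  by apply: cvgM; [exact: cvg_cst|apply: cvgD; exact: l2_cvg].
rewrite -(cvg_lim _ h)//; apply: lim_series_le; first exact: l2_cvg.
  by apply/cvg_ex; eexists; exact: h.
move=> j; rewrite -[(x + y) j]/(x j + y j).
have := ler_normc_add (x j) (y j); have := normc_ge0 (x j + y j).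
set a := Normc.normc (x j); set b := Normc.normc (y j).
set c := Normc.normc _ => c0 cab.
rewrite -mulrDr [leRHS]mulrCA ler_wpM2l//.
(* From [c <= a + b], [c ^+ 2] is at most [(a + b) ^+ 2]; expanding [(a - b) ^+ 2 >= 0] absorbs the
   cross term. *)
have := sqr_ge0 (a - b); nra.
Qed.

Lemma truncation_cvg {R : realType} {mu : nat -> {posnum R}}
    (U : contractive_op mu) (x : ell2 mu) :
  (fun n => l2norm (truncation U n x - U x)) @ \oo --> (0 : R).
Proof.
apply: (@squeeze_cvgr _ _ _ _ (fun=> 0) (fun n => 2 *
  (l2norm (pad mu (coords n x) - x) +
   l2norm (pad mu (coords n (U x)) - U x)))); last 2 first.
- exact: cvg_cst.
- rewrite -[X in _ --> X](mulr0 2) -[X in 2 * X](addr0 0).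
  by apply: cvgM; [exact: cvg_cst|apply: cvgD; exact: pad_coords_cvg].
apply: nearW => n; rewrite l2norm_ge0/=.
(* The first summand is bounded by the projection error at [x], as [U] and the projection are
   contractions; the second is the projection error at [U x]. *)
have -> : pad mu (coords n (U (pad mu (coords n x)))) - U x =
    pad mu (coords n (U (pad mu (coords n x) - x))) +
    (pad mu (coords n (U x)) - U x).
  by rewrite !linearB/= addrA subrK.
apply: le_trans (l2norm_quasi_triangle _ _) _.
rewrite ler_pM2l// lerD2r.
exact: le_trans (l2norm_pad_coords _ _) (contractive_opP _ _).
Qed.

Section ell1_truncation.
Context {R : realType}.
Implicit Types x y : ell1 R.

Lemma l1norm_ge0 x : 0 <= l1norm x.
Proof.
apply: le_trans (ler_series_lim 0 (fun j => normc_ge0 (x j)) (l1_cvg x)).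
by rewrite big_ord0.
Qed.

Lemma l1norm_triangle x y : l1norm (x + y) <= l1norm x + l1norm y.
Proof.
have h : series (fun j => Normc.normc (x j) + Normc.normc (y j)) @ \oo -->
    l1norm x + l1norm y.
  rewrite (_ : series _ = series (fun j => Normc.normc (x j)) +
    series (fun j => Normc.normc (y j))); last first.
    by apply/funext => n; rewrite /series/= big_split.
  by apply: cvgD; exact: l1_cvg.
rewrite -(cvg_lim _ h)//; apply: lim_series_le; first exact: l1_cvg.
  by apply/cvg_ex; eexists; exact: h.
by move=> j; exact: ler_normc_add.
Qed.

Lemma l1cut_subproof n x :
  (fun j => if (j < n)%N then x j else 0) \in @abs_summable R.
Proof.
rewrite inE/=; apply/cvg_ex; eexists; apply: (@cvg_series_finsupp _ _ n).
by move=> j nj; rewrite ltnNge nj Normc.normc0.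
Qed.

(** The projection [P_n] on [l^1], given directly on sequences because [pad] takes values in the
    weighted space [ell2]. *)
Definition l1cut n x : ell1 R := L1 (l1cut_subproof n x).

Lemma l1cutB n x y : l1cut n (x - y) = l1cut n x - l1cut n y.
Proof.
apply/val_inj/funext => j /=; rewrite -[RHS]/(l1cut n x j - l1cut n y j) /=.
by case: ifP; rewrite ?subr0.
Qed.

Lemma l1norm_cut n x : l1norm (l1cut n x) <= l1norm x.
Proof.
apply: lim_series_le; [exact: l1_cvg..|] => j /=.
by case: ifP => // _; rewrite Normc.normc0 normc_ge0.
Qed.

(** The error is exactly the tail of the convergent series defining [l1norm x]. *)
Lemma l1cut_cvg x : (fun n => l1norm (l1cut n x - x)) @ \oo --> (0 : R).
Proof.
pose t j := Normc.normc (x j).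
have e n : l1norm (l1cut n x - x) = l1norm x - series t n.
  apply/cvg_lim => //.
  (* The error has terms [t j - u j], and [u], being finitely supported, sums to the [n]-th partial
     sum of [t]. *)
  pose u j := if (j < n)%N then t j else 0.
  rewrite (_ : series _ = series t - series u); last first.
    apply/funext => N; rewrite -[RHS]/(_ - _) /series/= -sumrB.
    apply: eq_bigr => j _; rewrite -[(_ - _) j]/(l1cut n x j - x j) /u /=.
    by case: ifP => _; rewrite ?subrr ?Normc.normc0// sub0r normcN subr0.
  apply: cvgB; first exact: l1_cvg.
  rewrite (_ : series t n = \sum_(j < n) u j).
    by apply: cvg_series_finsupp => j nj; rewrite /u ltnNge nj.
  by rewrite /series/= big_mkord; apply: eq_bigr => j _; rewrite /u ltn_ord.
under eq_fun do rewrite e.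
rewrite -(subrr (l1norm x)).
by apply: cvgB; [exact: cvg_cst|exact: l1_cvg].
Qed.

End ell1_truncation.

(** Entries of [b(U)] depend on [U] entrywise, so truncating [U] keeps the leading [n] by [n] block
    of [b(U)]: the right cut removes columns, the left one rows. *)
Lemma bop_truncation {R : realType} {mu : nat -> {posnum R}}
    (U : contractive_op mu) n (x : ell1 R) :
  bop (truncation U n) x = l1cut n (bop U (l1cut n x)).
Proof.
apply/val_inj/funext => j /=; rewrite /bop_seq.
case: ifP => jn.
  congr csum; apply/funext => k; rewrite b_entry_trunc jn /=.
  by case: ifP; rewrite ?mulr0 ?mul0r.
rewrite (_ : (fun k => _) = fun=> 0); last first.
  by apply/funext => k; rewrite b_entry_trunc jn /= mul0r.
apply: csum_eq; apply: cvg_near_cst; apply: nearW => n'.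
by rewrite /series/= big1.
Qed.

Lemma bop_truncation_cvg {R : realType} {mu : nat -> {posnum R}}
    (U : contractive_op mu) (x : ell1 R) :
  (fun n => l1norm (bop (truncation U n) x - bop U x)) @ \oo --> (0 : R).
Proof.
apply: (@squeeze_cvgr _ _ _ _ (fun=> 0) (fun n =>
  l1norm (l1cut n x - x) + l1norm (l1cut n (bop U x) - bop U x))); last 2 first.
- exact: cvg_cst.
- by rewrite -[X in _ --> X](addr0 0); apply: cvgD; exact: l1cut_cvg.
apply: nearW => n; rewrite l1norm_ge0/= bop_truncation.
have -> : l1cut n (bop U (l1cut n x)) - bop U x =
    l1cut n (bop U (l1cut n x - x)) + (l1cut n (bop U x) - bop U x).
  by rewrite (linearB (bop U)) l1cutB addrA subrK.
apply: le_trans (l1norm_triangle _ _) _; rewrite lerD2r.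
exact: le_trans (l1norm_cut _ _) (l1norm_b _ _).
Qed.

(** Strong convergence passes to powers because the norms of the [B_n] are bounded uniformly in
    [n]. *)
Lemma iter_bop_truncation_cvg {R : realType} {mu : nat -> {posnum R}}
    (U : contractive_op mu) (m : nat) (x : ell1 R) :
  (fun n => l1norm (iter m (bop (truncation U n)) x - iter m (bop U) x)) @ \oo
    --> (0 : R).
Proof.
elim: m => [|m IH].
  apply: cvg_near_cst; apply: nearW => n /=; rewrite subrr; apply/cvg_lim => //.
  apply: cvg_near_cst; apply: nearW => N.
  by rewrite /series/= big1// => j _; exact: Normc.normc0.
apply: (@squeeze_cvgr _ _ _ _ (fun=> 0) (fun n =>
  l1norm (iter m (bop (truncation U n)) x - iter m (bop U) x) +
  l1norm (bop (truncation U n) (iter m (bop U) x) -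
          bop U (iter m (bop U) x)))); last 2 first.
- exact: cvg_cst.
- rewrite -[X in _ --> X](addr0 0).
  by apply: cvgD; [exact: IH|exact: bop_truncation_cvg].
apply: nearW => n; rewrite l1norm_ge0 !iterS.
set y := iter m _ x; set z := iter m (bop U) x.
have -> : bop (truncation U n) y - bop U z =
    bop (truncation U n) (y - z) + (bop (truncation U n) z - bop U z).
  by rewrite (linearB (bop (truncation U n))) addrA subrK.
(* Each truncation is itself a contraction, so [B_n] does not enlarge the error [y - z] of the
   previous power. *)
by apply: le_trans (l1norm_triangle _ _) _; rewrite lerD2r l1norm_b.
Qed.

Theorem lemma8p2 (R : realType) (mu : nat -> {posnum R})
    (mu_sum1 : series (fun j => (mu j)%:num) @ \oo --> (1 : R))
    (U : contractive_op mu) :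
  (forall x : ell2 mu,
     (fun n => l2norm (truncation U n x - U x)) @ \oo --> (0 : R)) /\
  (forall (m : nat) (x : ell1 R),
     (fun n => l1norm (iter m (bop (truncation U n)) x - iter m (bop U) x)) @ \oo
       --> (0 : R)).
Proof.
split=> [x|m x]; first exact: truncation_cvg.
exact: iter_bop_truncation_cvg.
Qed.
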